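(* Let $\Bbbk$ be a field of characteristic $0$. The series $\mathtt{E}$ of $\mathbf{\Sigma}$ is primitive, and for each nonempty finite set $I$ the element $\mathtt{E}_I$ is an idempotent of the Tits algebra $(\mathbf{\Sigma}[I],\triangleright)$.
   Context: A composition $F=(I_1,\dots,I_k)\vDash I$ of a finite set $I$ is a sequence of pairwise disjoint nonempty subsets with union $I$; $\ell(F)=k$. $\mathbf{\Sigma}[I]$ is the $\Bbbk$-vector space with basis $\mathtt{H}_F$, $F\vDash I$; bijections act by transport. For $I=S\sqcup T$ (disjoint subsets with union $I$), the coproduct $\Delta_{S,T}:\mathbf{\Sigma}[I]\to\mathbf{\Sigma}[S]\otimes\mathbf{\Sigma}[T]$ is $\Delta_{S,T}(\mathtt{H}_F)=\mathtt{H}_{F|_S}\otimes\mathtt{H}_{F|_T}$, where $F|_S$ is the list of the nonempty sets among $I_1\cap S,\dots,I_k\cap S$, in order. The Tits algebra is $\mathbf{\Sigma}[I]$ with the bilinear product $\mathtt{H}_F\triangleright\mathtt{H}_G=\mathtt{H}_{FG}$, where for $F=(S_1,\dots,S_p)$ and $G=(T_1,\dots,T_q)$ the composition $FG$ lists the nonempty intersections $S_i\cap T_j$ in lexicographic order of $(i,j)$. A series of $\mathbf{\Sigma}$ is a family $s_I\in\mathbf{\Sigma}[I]$, one for each finite set $I$, compatible with bijections. It is primitive if $s_\emptyset=0$ and $\Delta_{S,T}(s_I)=0$ for all $I=S\sqcup T$ with $S,T\neq\emptyset$. $\mathtt{E}$ (the first Eulerian idempotent) is the series with $\mathtt{E}_\emptyset=0$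 and $\mathtt{E}_I=\sum_{F\vDash I}(-1)^{\ell(F)-1}\frac{1}{\ell(F)}\mathtt{H}_F$ for $I\ne\emptyset$. *)

(* Defs.v *)
From HB Require Import structures.
From mathcomp Require Import all_boot all_order all_algebra.

Set Implicit Arguments.
Unset Strict Implicit.
Unset Printing Implicit Defensive.

Import GRing.Theory.
Local Open Scope ring_scope.

Definition is_comp (I : finType) (F : seq {set I}) : bool :=
  [&& all (fun B => B != set0) F,
      pairwise (fun A B : {set I} => [disjoint A & B]) F
    & \bigcup_(B <- F) B == [set: I]].

Record comp (I : finType) := Comp {
  blocks :> seq {set I};
  blocksP : is_comp blocks
}.

HB.instance Definition _ (I : finType) := [isSub for @blocks I].
HB.instance Definition _ (I : finType) := [Countable of comp I by <:].

Lemma card_bigcup_pairwise (I : finType) (F : seq {set I}) :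
  pairwise (fun A B : {set I} => [disjoint A & B]) F ->
  #|\bigcup_(B <- F) B| = (\sum_(B <- F) #|B|)%N.
Proof.
elim: F => [|A F IH] /=; first by rewrite !big_nil cards0.
case/andP=> dA dF; rewrite !big_cons -(IH dF) cardsU.
suff -> : A :&: \bigcup_(B <- F) B = set0 by rewrite cards0 subn0.
elim: F dA {IH dF} => [|B F IH] /=; first by rewrite big_nil setI0.
case/andP=> dB dF; rewrite big_cons setIUr IH // setU0.
exact: disjoint_setI0.
Qed.

Lemma size_comp (I : finType) (F : comp I) : (size F <= #|I|)%N.
Proof.
case: F => F /= /and3P [ne dF /eqP cF].
rewrite -cardsT -cF card_bigcup_pairwise // {dF cF}.
elim: F ne => [|A F IH] //= /andP [nA nF].
rewrite big_cons -add1n leq_add ?IH // card_gt0 //.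
Qed.

Definition comp_bseq (I : finType) (F : comp I) : #|I|.-bseq {set I} :=
  Bseq (size_comp F).

Lemma comp_bseqK (I : finType) :
  pcancel (@comp_bseq I)
          (fun b : #|I|.-bseq {set I} => insub (b : seq {set I})).
Proof. by move=> F; exact: valK. Qed.

HB.instance Definition _ (I : finType) : isFinite (comp I) :=
  PCanIsFinite (@comp_bseqK I).

Definition nonempty_blocks (I : finType) (F : seq {set I}) : seq {set I} :=
  [seq B <- F | B != set0].

Lemma bigcup_nonempty (I : finType) (F : seq {set I}) :
  \bigcup_(B <- nonempty_blocks F) B = \bigcup_(B <- F) B.
Proof.
elim: F => [|A F IH] //=; rewrite big_cons -IH.
by case: eqVneq => [->|_] /=; rewrite ?set0U ?big_cons.
Qed.

Lemma is_comp_nonempty (I : finType) (F : seq {set I}) :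
  pairwise (fun A B : {set I} => [disjoint A & B]) F ->
  \bigcup_(B <- F) B = [set: I] -> is_comp (nonempty_blocks F).
Proof.
move=> dF cF; apply/and3P; split; first exact: filter_all.
  exact: (subseq_pairwise (filter_subseq _ _) dF).
by rewrite bigcup_nonempty cF.
Qed.

Lemma in_bigcup_seq (I : finType) (F : seq {set I}) (x : I) :
  (x \in \bigcup_(B <- F) B) = has (fun B : {set I} => x \in B) F.
Proof. by elim: F => [|A F IH]; rewrite ?big_nil ?big_cons !inE ?IH. Qed.

Lemma comp_cover (I : finType) (F : comp I) (x : I) :
  has (fun B : {set I} => x \in B) F.
Proof. by case: F => F /= /and3P [_ _ /eqP cF]; rewrite -in_bigcup_seq cF inE. Qed.

Lemma comp_disjoint (I : finType) (F : comp I) :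
  pairwise (fun A B : {set I} => [disjoint A & B]) F.
Proof. by case: F => F /= /and3P []. Qed.

Lemma restrict_subproof (I : finType) (S : {set I}) (F : comp I) :
  is_comp (nonempty_blocks
    [seq [set x : {x : I | x \in S} | val x \in B] | B : {set I} <- F]).
Proof.
apply: is_comp_nonempty.
  rewrite pairwise_map; apply: sub_pairwise (comp_disjoint F) => A B /= dAB.
  apply/pred0P => x /=; rewrite !inE; exact: (pred0P dAB (val x)).
apply/setP=> x; rewrite in_bigcup_seq has_map inE.
by rewrite -[RHS](comp_cover F (val x)); apply: eq_has => B /=; rewrite inE.
Qed.

(* The finite set S is the finType {x | x \in S}; the trace of a block B on it
   is the set of the x of that type whose value lies in B. *)
Definition restrict (I : finType) (S : {set I}) (F : comp I) :
    comp {x : I | x \in S} :=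
  @Comp _ (nonempty_blocks
    [seq [set x : {x : I | x \in S} | val x \in B] | B : {set I} <- F])
    (restrict_subproof S F).

Lemma comp_mul_subproof (I : finType) (F G : comp I) :
  is_comp (nonempty_blocks [seq A :&: B | A <- F, B <- G]).
Proof.
apply: is_comp_nonempty; last first.
  apply/setP=> x; rewrite in_bigcup_seq inE.
  have /hasP [A AF xA] := comp_cover F x; have /hasP [B BG xB] := comp_cover G x.
  apply/hasP; exists (A :&: B); last by rewrite inE xA.
  by apply/allpairsP; exists (A, B).
have dG := comp_disjoint G; have := comp_disjoint F.
elim: (blocks F) => [|A s IH] //= /andP [dA ds].
rewrite pairwise_cat IH // andbT; apply/andP; split.
  apply/allrelP => X Y /mapP [B _ ->] /allpairsP [[A' B'] /= [A's _ ->]].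
  have dAA' := allP dA _ A's.
  apply: disjointWl (subsetIl _ _) _; apply: disjointWr (subsetIl _ _) dAA'.
rewrite pairwise_map; apply: sub_pairwise dG => B B' /= dB.
apply: disjointWl (subsetIr _ _) _; exact: disjointWr (subsetIr _ _) dB.
Qed.

(* [seq _ | A <- F, B <- G] enumerates the pairs with the index in F varying
   slowest, i.e. in lexicographic order. *)
Definition comp_mul (I : finType) (F G : comp I) : comp I :=
  @Comp _ (nonempty_blocks [seq A :&: B | A <- F, B <- G])
    (comp_mul_subproof F G).

Lemma comp_map_subproof (I J : finType) (f : I -> J) (bf : bijective f)
  (F : comp I) : is_comp [seq f @: (B : {set I}) | B <- F].
Proof.
have injf := bij_inj bf.
apply/and3P; split.
- rewrite all_map; apply: sub_all (_ : all (fun B => B != set0) F).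
    by move=> B /=; rewrite imset_eq0.
  by case: (F) => s /= /and3P [].
- rewrite pairwise_map; apply: sub_pairwise (comp_disjoint F) => A B /= dAB.
  by rewrite imset_disjoint //; exact: in2W.
- apply/eqP/setP => y; rewrite in_bigcup_seq has_map inE.
  case: bf => g _ gK; have /hasP [B BF gB] := comp_cover F (g y).
  by apply/hasP; exists B => //=; rewrite -(gK y) imset_f.
Qed.

Definition comp_map (I J : finType) (f : I -> J) (bf : bijective f)
    (F : comp I) : comp J :=
  @Comp _ [seq f @: (B : {set I}) | B <- F] (comp_map_subproof bf F).

(* The k-vector space with basis a finite type, as coordinate functions. *)
Definition freemod (k : fieldType) (X : finType) := {ffun X -> k^o}.
HB.instance Definition _ (k : fieldType) (X : finType) :=
  GRing.Lmodule.on (freemod k X).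
HB.instance Definition _ (k : fieldType) (X : finType) :=
  Vector.on (freemod k X).

Definition basis_elt (k : fieldType) (X : finType) (x : X) : freemod k X :=
  [ffun y => (y == x)%:R].

Lemma freemod_basisE (k : fieldType) (X : finType) (u : freemod k X) :
  u = \sum_x u x *: basis_elt k x.
Proof.
apply/ffunP=> y; rewrite sum_ffunE (bigD1 y) //= !ffunE eqxx big1 ?addr0.
  by rewrite /GRing.scale /= mulr1.
by move=> x nxy; rewrite !ffunE eq_sym (negPf nxy) /GRing.scale /= mulr0.
Qed.

Lemma sum_basis (k : fieldType) (X : finType) (V : lmodType k) (x : X)
  (f : X -> V) : \sum_y basis_elt k x y *: f y = f x.
Proof.
rewrite (bigD1 x) //= ffunE eqxx scale1r big1 ?addr0 // => y nyx.
by rewrite ffunE (negPf nyx) scale0r.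
Qed.

(* The tensor product of the spaces with bases X and Y is the space with basis
   X * Y, the basis element (x, y) being the pure tensor of x and y. *)
Definition tensor (k : fieldType) (X Y : finType)
    (u : freemod k X) (v : freemod k Y) : freemod k (X * Y)%type :=
  [ffun p => u p.1 * v p.2].

Lemma tensor_basis (k : fieldType) (X Y : finType) (x : X) (y : Y) :
  tensor (basis_elt k x) (basis_elt k y) = basis_elt k (x, y).
Proof. by apply/ffunP=> [[x' y']]; rewrite !ffunE /= -natrM mulnb xpair_eqE. Qed.

Definition Sigma (k : fieldType) (I : finType) := freemod k (comp I).

Definition Hbasis (k : fieldType) (I : finType) (F : comp I) : Sigma k I :=
  basis_elt k F.

Definition Sigma_map (k : fieldType) (I J : finType) (f : I -> J)
    (bf : bijective f) (u : Sigma k I) : Sigma k J :=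
  \sum_(F : comp I) u F *: Hbasis k (comp_map bf F).

(* Meaningful for arbitrary S and T; only used when I is their disjoint
   union. *)
Definition coproduct (k : fieldType) (I : finType) (S T : {set I})
    (u : Sigma k I) :
    freemod k (comp {x : I | x \in S} * comp {x : I | x \in T})%type :=
  \sum_(F : comp I)
    u F *: tensor (Hbasis k (restrict S F)) (Hbasis k (restrict T F)).

Definition tits_mul (k : fieldType) (I : finType) (u v : Sigma k I) :
    Sigma k I :=
  \sum_(F : comp I) \sum_(G : comp I) (u F * v G) *: Hbasis k (comp_mul F G).

Lemma Sigma_map_H (k : fieldType) (I J : finType) (f : I -> J)
  (bf : bijective f) (F : comp I) :
  Sigma_map bf (Hbasis k F) = Hbasis k (comp_map bf F).
Proof. exact: sum_basis. Qed.

Lemma coproduct_H (k : fieldType) (I : finType) (S T : {set I}) (F : comp I) :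
  coproduct S T (Hbasis k F) =
  tensor (Hbasis k (restrict S F)) (Hbasis k (restrict T F)).
Proof. exact: sum_basis. Qed.

Lemma tits_mul_H (k : fieldType) (I : finType) (F G : comp I) :
  tits_mul (Hbasis k F) (Hbasis k G) = Hbasis k (comp_mul F G).
Proof.
rewrite -[RHS](sum_basis F (fun F' => Hbasis k (comp_mul F' G))).
apply: eq_bigr => F' _.
rewrite -(sum_basis G (fun G' => Hbasis k (comp_mul F' G'))) scaler_sumr.
by apply: eq_bigr => G' _; rewrite scalerA.
Qed.

Definition is_series (k : fieldType) (s : forall I : finType, Sigma k I) :=
  forall (I J : finType) (f : I -> J) (bf : bijective f),
    Sigma_map bf (s I) = s J.

Definition is_primitive (k : fieldType) (s : forall I : finType, Sigma k I) :=
  [/\ is_series s,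
      forall I : finType, #|I| = 0%N -> s I = 0
    & forall (I : finType) (S T : {set I}),
        S :|: T = [set: I] -> [disjoint S & T] ->
        S != set0 -> T != set0 -> coproduct S T (s I) = 0].

Definition Eulerian (k : fieldType) (I : finType) : Sigma k I :=
  if #|I| == 0%N then 0
  else \sum_(F : comp I)
         ((-1) ^+ (size F).-1 * ((size F)%:R)^-1) *: Hbasis k F.

(* Main.v *)
(* Primitivity: for a finite ordered set X, the functions I -> X whose ordered
   list of nonempty level sets is F number C(#|X|, l(F)), and a function on
   I = S + T is a pair of functions on S and T. Hence, for G and H compositions
   of S and T, the sum of C(m, l(F)) over the F restricting to G and H is
   C(m, l(G)) C(m, l(H)). As k has characteristic 0 this is an identity of
   polynomials in m; the linear coefficient of C(m, n) is (-1)^(n-1)/n, and that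
   of the right-hand side is 0 when S and T are nonempty.
   Idempotence: if F has at least two blocks, the first being S, then FG depends
   on G only through its restrictions to S and to its complement, so H_F
   annihilates primitive elements; the one-block composition is a left unit, and
   its coefficient in E_I is 1. *)
From mathcomp Require Import all_boot all_order all_algebra.
Require Import Defs.

Set Implicit Arguments.
Unset Strict Implicit.
Unset Printing Implicit Defensive.

Import GRing.Theory.
Local Open Scope ring_scope.

(** * Binomial coefficients as polynomials in characteristic 0 *)

Section BinomialPolynomial.
Variable k : fieldType.
Hypothesis hk : [pchar k] =i pred0.

Lemma natr_neq0_pchar0 n : (0 < n)%N -> n%:R != 0 :> k.
Proof. by rewrite ((pcharf0P k).1 hk) lt0n. Qed.

(** The points [m.+1] are distinct in characteristic 0, so [p - q] has more roots than its degree
    allows. Starting at 1 keeps the sets of values nonempty in the counting below. *)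
Lemma poly_eq_natP (p q : {poly k}) :
  (forall m : nat, p.[m.+1%:R] = q.[m.+1%:R]) -> p = q.
Proof.
move=> eqpq; apply/eqP; rewrite -subr_eq0; apply/eqP.
pose rs := [seq i.+1%:R : k | i <- iota 0 (size (p - q))].
apply: (@roots_geq_poly_eq0 _ _ rs); last by rewrite size_map size_iota.
  apply/allP=> _ /mapP[i _ ->].
  by rewrite /root hornerD hornerN eqpq subrr.
rewrite map_inj_uniq ?iota_uniq // => i j /eqP.
wlog le_ij : i j / (i <= j)%N => [hw|].
  by case/orP: (leq_total i j) => /hw // h /eqP e; rewrite h // e.
rewrite eq_sym -subr_eq0 -natrB // subSS ((pcharf0P k).1 hk) subn_eq0 => le_ji.
by apply/eqP; rewrite eqn_leq le_ij.
Qed.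

(** The polynomial $\binom{X}{n}$. *)
Definition binp (n : nat) : {poly k} :=
  (n`!%:R)^-1 *: \prod_(i < n) ('X - (i%:R)%:P).

Lemma horner_binp n m : (binp n).[m%:R] = 'C(m, n)%:R.
Proof.
have n0 : n`!%:R != 0 :> k by rewrite natr_neq0_pchar0 ?fact_gt0.
apply: (mulfI n0); rewrite -natrM mulnC bin_ffact hornerZ mulrA mulfV // mul1r.
rewrite horner_prod; elim: n {n0} => [|n IH]; first by rewrite big_ord0.
rewrite big_ord_recr /= {}IH hornerXsubC ffactnSr natrM.
(* For [m < n] the truncated [m - n] is harmless: the falling factorial is already 0. *)
by case: (leqP n m) => [/natrB ->|/ffact_small ->]; rewrite ?mul0r.
Qed.

Lemma binp0 n : (0 < n)%N -> (binp n).[0] = 0.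
Proof. by move=> n0; rewrite -[0]/(0%:R) horner_binp bin0n gtn_eqF. Qed.

(** Only the factor $X$ vanishes at 0, so the derivative there is the product of the others,
    $(-1)(-2)\cdots(-(n-1))$, over $n!$. *)
Lemma deriv_binp0 n : (0 < n)%N ->
  (binp n)^`().[0] = (-1) ^+ n.-1 * (n%:R)^-1.
Proof.
case: n => // n _; rewrite /binp big_ord_recl /= derivZ hornerZ derivM.
rewrite hornerD !hornerM hornerXsubC subrr mul0r addr0 derivXsubC hornerC mul1r.
rewrite horner_prod; have -> : \prod_(i < n) ('X - (lift ord0 i)%:R%:P).[0] =
    (-1) ^+ n * n`!%:R :> k.
  elim: n => [|n IH]; first by rewrite big_ord0 mulr1.
  rewrite big_ord_recr /= IH hornerXsubC sub0r factS natrM exprS.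
  by rewrite mulN1r mulrN mulNr -!mulrA [_%:R * _]mulrC.
by rewrite factS natrM invfM mulrC mulrA mulrAC mulfK // natr_neq0_pchar0 ?fact_gt0.
Qed.

End BinomialPolynomial.

(** * Compositions as ordered level sets of functions *)

Section LevelSets.
Variables (I T : finType).

Definition levels (f : I -> T) : seq {set I} := [seq f @^-1: [set t] | t <- enum T].

Lemma levels_subproof (f : I -> T) : is_comp (nonempty_blocks (levels f)).
Proof.
apply: is_comp_nonempty.
  rewrite pairwise_map; have := enum_uniq T; rewrite uniq_pairwise.
  apply: sub_pairwise => t u /= ntu; apply/pred0P=> x /=; rewrite !inE.
  by apply: contraNF ntu => /andP[/eqP<- /eqP<-].
apply/setP=> x; rewrite in_bigcup_seq inE has_map; apply/hasP.
by exists (f x); rewrite ?mem_enum //= !inE.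
Qed.

Definition level_comp (f : I -> T) : comp I := Comp (levels_subproof f).

Lemma level_compE (f : I -> T) :
  level_comp f = [seq f @^-1: [set t] | t <- enum (f @: [set: I])] :> seq _.
Proof.
rewrite /= /nonempty_blocks filter_map enumT; congr map.
rewrite /enum_mem; apply: eq_filter => t /=.
apply/set0Pn/imsetP => [[x]|[x _ ->]]; first by rewrite !inE => /eqP <-; exists x.
by exists x; rewrite !inE.
Qed.

Lemma eq_level_comp (f g : I -> T) : f =1 g -> level_comp f = level_comp g.
Proof.
move=> fg; apply: val_inj => /=; congr nonempty_blocks; apply: eq_map => t.
by apply/setP=> x; rewrite !inE fg.
Qed.

(** By disjointness the first block containing [x] is the only one. Out of range, [nth] gives the
    empty set, while [find] stays in range. *)
Lemma mem_nth_comp (F : comp I) (x : I) (j : nat) :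
  (x \in nth set0 F j) = (find (fun B : {set I} => x \in B) F == j).
Proof.
have hx := comp_cover F x; apply/idP/eqP => [xj|<-]; last exact: (nth_find set0 hx).
have xi := nth_find set0 hx; set i := find _ _ in xi *.
have lti : (i < size F)%N by rewrite -has_find.
have ltj : (j < size F)%N.
  by rewrite ltnNge; apply: contraTN xj => /(nth_default set0) ->; rewrite inE.
have /(pairwiseP set0) dF := comp_disjoint F.
case: (ltngtP i j) => // ij; [have := dF i j lti ltj ij|have := dF j i ltj lti ij];
  by move/pred0P/(_ x); rewrite /= xi xj.
Qed.

Lemma nth_comp_neq0 (F : comp I) j : (j < size F)%N -> nth set0 F j != set0.
Proof. by case: F => F /= /and3P[/all_nthP h _ _]; apply: h. Qed.

(** Such a function is determined by its image [A], any subset with [size F] elements: [g A] sends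
    the j-th block to the j-th element of [A]. *)
Lemma card_level_comp (t0 : T) (F : comp I) :
  #|[set f : {ffun I -> T} | level_comp f == F]| = 'C(#|T|, size F).
Proof.
pose g (A : {set T}) : {ffun I -> T} :=
  [ffun x => nth t0 (enum A) (find (fun B : {set I} => x \in B) F)].
have gE (A : {set T}) : #|A| = size F -> g A @: [set: I] = A.
  rewrite cardE => cA; apply/setP=> t; apply/imsetP/idP => [[x _ ->]|].
    by rewrite ffunE -mem_enum mem_nth // cA -has_find comp_cover.
  rewrite -mem_enum => /(nthP t0) [j]; rewrite cA => /nth_comp_neq0 /set0Pn [x].
  by rewrite mem_nth_comp => /eqP fx <-; exists x; rewrite ?inE // ffunE fx.
rewrite -card_draws -(card_in_imset (f := g)); last first.
  by move=> A B /[!inE] /eqP cA /eqP cB eqg; rewrite -(gE A) // eqg gE.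
  congr #|pred_of_set _|; apply/setP=> f; rewrite inE; apply/eqP/imsetP => [fF|[A]].
    exists (f @: [set: I]); first by rewrite inE -fF level_compE size_map cardE.
    apply/ffunP=> x; rewrite ffunE -fF level_compE find_map.
    rewrite (eq_find (a2 := pred1 (f x))) => [|t]; last by rewrite /= !inE eq_sym.
    by rewrite -[find _ _]/(index _ _) nth_index // mem_enum imset_f.
  rewrite inE => /eqP cA ->; apply: val_inj; rewrite [val _]level_compE gE //=.
  have szA : size (enum A) = size F by rewrite -cardE.
  apply: (@eq_from_nth _ set0) => [|j]; rewrite size_map // => ltj.
  rewrite (nth_map t0) //; apply/setP=> x; rewrite mem_nth_comp !inE ffunE.
  by rewrite nth_uniq ?enum_uniq // szA -has_find comp_cover.
Qed.

End LevelSets.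

(** * Level sets under restriction, and the counting identity *)

Lemma nonempty_blocks_map (I J : finType) (r : {set I} -> {set J}) (s : seq {set I}) :
  r set0 = set0 ->
  nonempty_blocks (map r (nonempty_blocks s)) = nonempty_blocks (map r s).
Proof.
move=> r0; elim: s => //= A s IH; case: (eqVneq A set0) => [->|_] /=.
  by rewrite r0 eqxx.
by case: ifP; rewrite IH.
Qed.

Lemma restrict_level_comp (I T : finType) (S : {set I}) (f : I -> T) :
  restrict S (level_comp f) = level_comp (fun x : {x : I | x \in S} => f (val x)).
Proof.
apply: val_inj => /=; rewrite nonempty_blocks_map; last by apply/setP=> x; rewrite !inE.
rewrite -map_comp; congr nonempty_blocks; apply: eq_map => t.
by apply/setP=> x; rewrite !inE.
Qed.

(** Double counting of the functions to [X] whose restrictions to [S] and [T] have level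
    compositions [G] and [H]. *)
Lemma sum_bin_restrict (I : finType) (S T : {set I}) (m : nat)
    (G : comp {x : I | x \in S}) (H : comp {x : I | x \in T}) :
  S :|: T = [set: I] -> [disjoint S & T] ->
  (\sum_(F : comp I | (restrict S F == G) && (restrict T F == H))
     'C(m.+1, size F) = 'C(m.+1, size G) * 'C(m.+1, size H))%N.
Proof.
move=> covST dST; pose X := 'I_m.+1.
have inST x : x \notin S -> x \in T.
  by move=> /negPf xS; have := in_setT x; rewrite -covST inE xS.
pose r (f : {ffun I -> X}) : {ffun {x | x \in S} -> X} * {ffun {x | x \in T} -> X} :=
  ([ffun x => f (val x)], [ffun x => f (val x)]).
(* Gluing; the default [ord0] is never reached, since a point outside [S] lies in [T]. *)
pose r' (p : {ffun {x | x \in S} -> X} * {ffun {x | x \in T} -> X}) : {ffun I -> X} :=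
  [ffun x => oapp p.1 (oapp p.2 ord0 (insub x)) (insub x)].
have r'K : cancel r' r.
  move=> [g h]; congr (_, _); apply/ffunP=> x; rewrite !ffunE; first by rewrite valK.
  have xS : (val x \in S) = false.
    by apply/negP=> xS; have := pred0P dST (val x); rewrite /= xS (valP x).
  have -> : insub (val x) = None :> option {x | x \in S} by apply: insubF.
  by rewrite /= valK.
have rK : cancel r r'.
  move=> f; apply/ffunP=> x; rewrite !ffunE; case: (insubP {x | x \in S} x) => [y _ <-|xS] /=.
    by rewrite ffunE.
  by rewrite (insubT (fun x => x \in T) (inST _ xS)) /= ffunE.
have cX n : 'C(m.+1, n) = 'C(#|{: X}|, n) by rewrite card_ord.
rewrite !cX -!(card_level_comp ord0) -cardsX -(card_imset _ (can_inj r'K)).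
pose Q (F : comp I) := (restrict S F == G) && (restrict T F == H).
transitivity #|[set f : {ffun I -> X} | Q (level_comp f)]|.
  rewrite -sum1dep_card (partition_big (fun f : {ffun I -> X} => level_comp f) Q) //=.
  apply: eq_bigr => F QF; rewrite cX -(card_level_comp ord0) -sum1dep_card.
  by apply: eq_bigl => f; rewrite andbC; case: eqP => //= ->; rewrite [Q F]QF.
congr #|pred_of_set _|; apply/setP=> f; rewrite -[f in RHS]rK (mem_imset _ _ (can_inj r'K)).
rewrite !inE /Q !restrict_level_comp.
by congr (_ && _); congr (_ == _); apply: eq_level_comp => x; rewrite ffunE.
Qed.

(** * Coordinates of sums and coproducts *)

Section FreeModule.
Variable k : fieldType.

Lemma sum_scale_basisE (X : finType) (a : X -> k) (x : X) :
  (\sum_y a y *: basis_elt k y : freemod k X) x = a x.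
Proof.
have -> : \sum_y a y *: basis_elt k y = [ffun y => a y] :> freemod k X.
  by rewrite [RHS]freemod_basisE; apply: eq_bigr => y _; rewrite ffunE.
by rewrite ffunE.
Qed.

Lemma coproductE (I : finType) (S T : {set I}) (u : Sigma k I) G H :
  coproduct S T u (G, H) =
  \sum_(F : comp I | (restrict S F == G) && (restrict T F == H)) u F.
Proof.
rewrite [RHS]big_mkcond sum_ffunE; apply: eq_bigr => F _.
rewrite /Hbasis tensor_basis !ffunE /GRing.scale /= xpair_eqE.
by rewrite eq_sym (eq_sym H); case: ifP; rewrite ?mulr1 ?mulr0.
Qed.

End FreeModule.

(** * Naturality and primitivity of the Eulerian series *)

Section Eulerian.
Variable k : fieldType.
Hypothesis hk : [pchar k] =i pred0.

Lemma EulerianE (I : finType) (F : comp I) : (0 < #|I|)%N ->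
  Eulerian k I F = (-1) ^+ (size F).-1 * (size F)%:R^-1.
Proof. by rewrite lt0n /Eulerian => /negPf ->; rewrite sum_scale_basisE. Qed.

Lemma comp_size_gt0 (I : finType) (F : comp I) : (0 < #|I|)%N -> (0 < size F)%N.
Proof. by case/card_gt0P=> x _; have := comp_cover F x; case: (blocks F). Qed.

Lemma Eulerian_is_series : is_series (Eulerian k).
Proof.
move=> I J f bf; have [g fK gK] := bf.
have bg : bijective g by exists f.
have cIJ : #|I| = #|J| := bij_eq_card bf.
have [/eqP J0|] := posnP #|J|.
  rewrite /Sigma_map /Eulerian cIJ J0; apply: big1 => F _.
  by rewrite ffunE scale0r.
move=> J0; have I0 : (0 < #|I|)%N by rewrite cIJ.
(* Transport along [g] inverts transport along [f] and preserves the number of blocks, on which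
   alone the coefficients depend. *)
rewrite [RHS]freemod_basisE /Sigma_map (reindex (comp_map bg)) /=; last first.
  by exists (comp_map bf) => F _; apply: val_inj; rewrite /= -map_comp -[RHS]map_id;
    apply: eq_map => B /=; rewrite -imset_comp -[RHS]imset_id; apply: eq_imset => x /=.
apply: eq_bigr => F _; rewrite !EulerianE //= size_map; congr (_ *: Hbasis k _).
apply: val_inj; rewrite /= -map_comp -[RHS]map_id; apply: eq_map => B /=.
by rewrite -imset_comp -[RHS]imset_id; apply: eq_imset => x /=.
Qed.

Lemma coproduct_Eulerian (I : finType) (S T : {set I}) :
  S :|: T = [set: I] -> [disjoint S & T] -> S != set0 -> T != set0 ->
  coproduct S T (Eulerian k I) = 0.
Proof.
move=> covST dST nS nT; apply/ffunP=> [[G H]]; rewrite coproductE [RHS]ffunE.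
have I0 : (0 < #|I|)%N by case/set0Pn: nS => x _; apply/card_gt0P; exists x.
have sG : (0 < size G)%N by rewrite comp_size_gt0 // card_sig card_gt0.
have sH : (0 < size H)%N by rewrite comp_size_gt0 // card_sig card_gt0.
(* The derivative at 0 extracts the linear coefficient, which for [binp k (size F)] is the
   coefficient of the Eulerian element at [F]. *)
have /(congr1 (fun p => p^`().[0])) :
    \sum_(F : comp I | (restrict S F == G) && (restrict T F == H)) binp k (size F) =
    binp k (size G) * binp k (size H).
  apply: (poly_eq_natP hk) => m; rewrite hornerM horner_sum !(horner_binp hk).
  by rewrite -natrM -sum_bin_restrict // natr_sum; apply: eq_bigr => F _; rewrite horner_binp.
(* Both factors vanish at 0, hence so does the derivative of their product. *)
rewrite derivM hornerD !hornerM !(binp0 hk) // mulr0 mul0r addr0.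
rewrite raddf_sum horner_sum /= => eq0; rewrite -[RHS]eq0; apply: eq_bigr => F _.
by rewrite EulerianE // deriv_binp0 // comp_size_gt0.
Qed.

End Eulerian.

(** * Left multiplication by a composition, and idempotence *)

Lemma nonempty_blocks_setI (I : finType) (S A : {set I}) (G : comp I) :
  A \subset S ->
  nonempty_blocks [seq A :&: B | B <- G] =
  nonempty_blocks [seq A :&: (val @: C) | C : {set {x : I | x \in S}} <- restrict S G].
Proof.
move=> sAS; rewrite nonempty_blocks_map ?imset0 ?setI0 // -map_comp.
congr nonempty_blocks; apply: eq_map => B /=.
apply/setP=> x; rewrite !inE; case: (boolP (x \in A)) => //= xA.
apply/idP/imsetP => [xB|[y]]; last by rewrite inE => yB ->.
by exists (exist _ x (subsetP sAS _ xA)); rewrite ?inE.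
Qed.

(** Each block [A] of [F] contributes the traces on [A] of the blocks of the right factor, and these
    are read off from one of the two restrictions. *)
Lemma eq_comp_mul_restrict (I : finType) (S : {set I}) (F G G' : comp I) :
  {in (F : seq _), forall A : {set I}, (A \subset S) || (A \subset ~: S)} ->
  restrict S G = restrict S G' -> restrict (~: S) G = restrict (~: S) G' ->
  comp_mul F G = comp_mul F G'.
Proof.
move=> hF eqS eqC; apply: val_inj; rewrite /= /nonempty_blocks !filter_flatten -!map_comp.
congr flatten; apply/eq_in_map => A /hF /= /orP[] sA.
  by rewrite -!/(nonempty_blocks _) !(nonempty_blocks_setI _ sA) eqS.
by rewrite -!/(nonempty_blocks _) !(nonempty_blocks_setI _ sA) eqC.
Qed.

(** Group the [G] by their two restrictions: the product is constant on each group, and the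
    coefficients there add up to a coordinate of the coproduct. *)
Lemma sum_comp_mul_eq0 (k : fieldType) (I : finType) (S : {set I}) (F : comp I)
    (u : Sigma k I) :
  {in (F : seq _), forall A : {set I}, (A \subset S) || (A \subset ~: S)} ->
  coproduct S (~: S) u = 0 ->
  \sum_(G : comp I) u G *: Hbasis k (comp_mul F G) = 0.
Proof.
move=> hF u0; rewrite (partition_big (fun G => (restrict S G, restrict (~: S) G)) xpredT) //=.
apply: big1 => [[K L]] _; under eq_bigl do rewrite xpair_eqE.
case: (pickP (fun G => (restrict S G == K) && (restrict (~: S) G == L))) => [G0|noG]; last first.
  by rewrite big_pred0.
case/andP=> /eqP eK /eqP eL.
transitivity ((\sum_(G : comp I | (restrict S G == K) && (restrict (~: S) G == L)) u G) *:
  Hbasis k (comp_mul F G0)); last by rewrite -coproductE u0 ffunE scale0r.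
rewrite scaler_suml; apply: eq_bigr => G /andP[/eqP gK /eqP gL].
by rewrite (@eq_comp_mul_restrict _ S F G G0) ?gK ?gL.
Qed.

Lemma one_comp_subproof (I : finType) : (0 < #|I|)%N -> is_comp [:: [set: I]].
Proof.
move=> I0; apply/and3P; split=> //=; last by rewrite big_seq1.
by rewrite andbT -card_gt0 cardsT.
Qed.

Definition one_comp (I : finType) (I0 : (0 < #|I|)%N) : comp I :=
  Comp (one_comp_subproof I0).

Lemma one_comp_mul (I : finType) (I0 : (0 < #|I|)%N) (G : comp I) :
  comp_mul (one_comp I0) G = G.
Proof.
apply: val_inj; rewrite /= cats0 (eq_map (@setTI _)) map_id.
by case: G => G /= /and3P[/all_filterP].
Qed.

(** Take the first block for [S]: the later blocks are disjoint from it, and the second one makes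
    the complement nonempty. *)
Lemma comp_neq_one (I : finType) (I0 : (0 < #|I|)%N) (F : comp I) :
  F != one_comp I0 ->
  exists S : {set I}, [/\ S != set0, ~: S != set0 &
    {in (F : seq _), forall A : {set I}, (A \subset S) || (A \subset ~: S)}].
Proof.
rewrite -val_eqE /=; have := comp_size_gt0 F I0.
case: F => -[|A [|B F]] //= /and3P[/= /andP[nA nF] dF covF] _ neq.
  by move: covF neq; rewrite big_seq1 => /eqP ->; rewrite eqxx.
have {dF} /andP[/allP dA _] : all (fun C : {set I} => [disjoint A & C]) (B :: F) && _ := dF.
exists A; split=> //.
  case/andP: nF => /set0Pn [x xB] _; apply/set0Pn; exists x; rewrite inE.
  by have := pred0P (dA B (mem_head _ _)) x; rewrite /= xB andbT => ->.
move=> C; rewrite inE => /predU1P[->|/dA]; first by rewrite subxx.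
by rewrite disjoint_sym disjoints_subset orbC => ->.
Qed.

Theorem proposition100 (k : fieldType) (hk : [pchar k] =i pred0) :
  is_primitive (Eulerian k) /\
  (forall I : finType, (0 < #|I|)%N ->
     tits_mul (Eulerian k I) (Eulerian k I) = Eulerian k I).
Proof.
split; first split.
- exact: Eulerian_is_series.
- by move=> I I0; rewrite /Eulerian I0.
- exact: coproduct_Eulerian.
(* The one-block term, with coefficient 1, returns the Eulerian element; every other [F] contributes
   0 by primitivity. *)
move=> I I0; rewrite /tits_mul (bigD1 (one_comp I0)) //= [X in _ + X]big1 => [|F /comp_neq_one].
  rewrite addr0 [RHS]freemod_basisE; apply: eq_bigr => G _.
  by rewrite one_comp_mul [X in X * _]EulerianE //= invr1 !mul1r.
case=> S [nS nC hF]; under eq_bigr do rewrite -scalerA.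
rewrite -scaler_sumr (sum_comp_mul_eq0 hF) ?scaler0 //.
apply: coproduct_Eulerian => //; first by rewrite setUCr.
by rewrite disjoints_subset setCK.
Qed.
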